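(* Let $(R,m)$ be a local ring of dimension $n$. Let $x_1,\dots,x_d\in m$ be a regular sequence on $R$, let $\mathbf{x}$ be the ideal generated by $x_1,\dots,x_d$, and let $\lambda$ be a zero-divisor and not a parameter on $R/\mathbf{x}$. Let $\Omega=\operatorname{Hom}_R(R/(\mathbf{x},\lambda),R/\mathbf{x})$. Let $K_\bullet(\mathbf{x},\lambda;R)$ (with differentials $\gamma_\bullet$) and $K_\bullet(\mathbf{x};R)$ denote the Koszul complexes on $x_1,\dots,x_d,\lambda$ and on $x_1,\dots,x_d$ respectively, and let $L_\bullet$ be a minimal free resolution of $\Omega$. Let $\psi_\bullet:L_\bullet\to K_\bullet(\mathbf{x},\lambda;R)(+1)$ be a lift of the inclusion $\Omega\simeq H_1(\mathbf{x},\lambda;R)\hookrightarrow G=\operatorname{Coker}\gamma_2$, and let $\phi_\bullet:L_\bullet\to K_\bullet(\mathbf{x};R)$ be a lift of the inclusion $\Omega\hookrightarrow R/\mathbf{x}$. Then $\operatorname{im}\psi_d=R$ if and only if $\operatorname{im}\phi_d=R$.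
   Context: ''Local ring'' means Noetherian local ring. $\Omega$ is identified with the ideal $(\mathbf{x}:\lambda)/\mathbf{x}$ of $R/\mathbf{x}$ (the annihilator of $\lambda$ in $R/\mathbf{x}$), which gives the inclusion $\Omega\hookrightarrow R/\mathbf{x}$; $H_1(\mathbf{x},\lambda;R)$ is the first Koszul homology, which is canonically isomorphic to $\Omega$ (by taking the coordinate of a cycle corresponding to $\lambda$). The map $\gamma_2:K_2(\mathbf{x},\lambda;R)\to K_1(\mathbf{x},\lambda;R)$ is the Koszul differential, and $K_\bullet(\mathbf{x},\lambda;R)(+1)$ is the complex whose degree-$i$ term, $i\ge 0$, is $K_{i+1}(\mathbf{x},\lambda;R)$, so that its zeroth homology is $G$. Thus $\psi_i:L_i\to K_{i+1}(\mathbf{x},\lambda;R)$ and $\phi_i:L_i\to K_i(\mathbf{x};R)$; in particular $\psi_d:L_d\to K_{d+1}(\mathbf{x},\lambda;R)=R$ and $\phi_d:L_d\to K_d(\mathbf{x};R)=R$. *)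

(* Defs.v *)
From HB Require Import structures.
From mathcomp Require Import all_boot all_order all_algebra.
From mathcomp Require Import generic_quotient ring_quotient boolp functions.

Set Implicit Arguments.
Unset Strict Implicit.
Unset Printing Implicit Defensive.

Import GRing.Theory.
Local Open Scope ring_scope.
Local Open Scope quotient_scope.

(* Ideals are subsets {pred R} of a commutative ring; [idealr_closed] and
   [prime_idealr_closed] are MathComp's, and [idealr_closed] ideals are
   proper. *)
Section Ideals.
Variable R : comNzRingType.
Implicit Types (s x : seq R) (m I J : {pred R}).

Definition idealgen s : {pred R^o} :=
  fun a => `[< exists c : 'I_(size s) -> R, a = \sum_i c i * s`_i >].

Lemma idealgenP s a :
  reflect (exists c : 'I_(size s) -> R, a = \sum_i c i * s`_i)
          (a \in idealgen s).
Proof. exact: asboolP. Qed.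

Fact idealgen_submod_closed s : submod_closed (idealgen s).
Proof.
split; first by apply/idealgenP; exists (fun=> 0); rewrite big1 // => i; rewrite mul0r.
move=> a u v /idealgenP[c ->] /idealgenP[e ->].
apply/idealgenP; exists (fun i => a * c i + e i).
rewrite [_ *: _]mulr_sumr -big_split /=; apply: eq_bigr => i _.
by rewrite mulrDl mulrA.
Qed.

HB.instance Definition _ s :=
  GRing.isSubmodClosed.Build R R^o (idealgen s) (idealgen_submod_closed s).

Definition noetherian : Prop :=
  forall I, idealr_closed I -> exists s, I =i idealgen s.

Definition maximal_ideal m : Prop :=
  idealr_closed m /\
  forall J, idealr_closed J -> {subset m <= J} -> J =i m.

Definition noetherian_local m : Prop :=
  [/\ noetherian, maximal_ideal m & forall J, maximal_ideal J -> J =i m].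

Definition prime_ideal I : Prop := idealr_closed I /\ prime_idealr_closed I.

(* P 0 < ... < P e is a strictly increasing chain of primes containing I. *)
Definition prime_chain I (e : nat) (P : nat -> {pred R}) : Prop :=
  (forall i, (i <= e)%N -> prime_ideal (P i) /\ {subset I <= P i}) /\
  (forall i, (i < e)%N ->
     {subset P i <= P i.+1} /\ ~ {subset P i.+1 <= P i}).

(* The Krull dimension of R / I is e. *)
Definition quot_dim I (e : nat) : Prop :=
  (exists P, prime_chain I e P) /\
  (forall k P, prime_chain I k P -> (k <= e)%N).

Definition krull_dim (e : nat) : Prop := quot_dim (pred1 0) e.

Definition regular_sequence x : Prop :=
  (forall i, (i < size x)%N -> forall a,
     x`_i * a \in idealgen (take i x) -> a \in idealgen (take i x)) /\
  1 \notin idealgen x.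

(* s is a system of parameters of R / (x), m the maximal ideal of R: its
   length is dim R / (x), and (x) + (s) is primary to m. *)
Definition system_of_parameters m x s : Prop :=
  [/\ {subset s <= m}, quot_dim (idealgen x) (size s)
    & forall a, a \in m -> exists k, a ^+ k \in idealgen (x ++ s)].

Definition is_parameter m x (lam : R) : Prop :=
  exists s, system_of_parameters m x (lam :: s).

End Ideals.

Section QuotientModule.
Variables (R : pzRingType) (V : lmodType R) (N : submodClosed V).

(* There is no canonical zmodClosed structure on a submodClosed. *)
Definition submod_zmod : {pred V} := [pred v | v \in N].

Fact submod_zmod_closed : zmod_closed submod_zmod.
Proof. exact/GRing.submod_closedB/submodClosedP. Qed.

HB.instance Definition _ :=
  GRing.isZmodClosed.Build V submod_zmod submod_zmod_closed.

Definition quotmod : Type := Quotient.quot submod_zmod.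
HB.instance Definition _ := GRing.Zmodule.on quotmod.
HB.instance Definition _ := EqQuotient.on quotmod.

Definition qproj (v : V) : quotmod := \pi_quotmod v.

Definition qscale (a : R) (q : quotmod) : quotmod := qproj (a *: repr q).

Lemma qprojK (q : quotmod) : qproj (repr q) = q.
Proof. exact: reprK. Qed.

Lemma qproj_eq u v : (qproj u = qproj v) <-> (u - v \in N).
Proof.
rewrite /qproj (Quotient.idealrBE submod_zmod u v); split=> [->|/eqP]//.
Qed.

Fact qproj_zmod_morphism : zmod_morphism qproj.
Proof. exact: (raddfB \pi_(Quotient.quot submod_zmod)). Qed.

HB.instance Definition _ :=
  GRing.isZmodMorphism.Build V quotmod qproj qproj_zmod_morphism.

Fact qprojZ a v : qproj (a *: v) = qscale a (qproj v).
Proof.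
by apply/qproj_eq; rewrite -scalerBr rpredZ //; apply/qproj_eq; rewrite qprojK.
Qed.

Fact qscaleA a b q : qscale a (qscale b q) = qscale (a * b) q.
Proof. by rewrite -(qprojK q) -!qprojZ scalerA. Qed.

Fact qscale1 : left_id 1 qscale.
Proof. by move=> q; rewrite /qscale scale1r qprojK. Qed.

Fact qscaleDr : right_distributive qscale +%R.
Proof.
move=> a q r; rewrite -(qprojK q) -(qprojK r) -raddfD -!qprojZ.
by rewrite scalerDr raddfD.
Qed.

Fact qscaleDl q : {morph qscale^~ q : a b / a + b}.
Proof. by move=> a b; rewrite -(qprojK q) -!qprojZ scalerDl raddfD. Qed.

HB.instance Definition _ := GRing.Zmodule_isLmodule.Build R quotmod
  qscaleA qscale1 qscaleDr qscaleDl.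
HB.instance Definition _ :=
  GRing.isScalable.Build R V quotmod *:%R qproj qprojZ.

End QuotientModule.

Section ImageModule.
Variables (R : pzRingType) (U V : lmodType R) (f : {linear U -> V}).

Definition image_mod : {pred V} := fun v => `[< exists u, f u = v >].

Fact image_mod_closed : submod_closed image_mod.
Proof.
split; first by apply/asboolP; exists 0; rewrite linear0.
move=> a _ _ /asboolP[u <-] /asboolP[v <-]; apply/asboolP.
by exists (a *: u + v); rewrite linearP.
Qed.

HB.instance Definition _ :=
  GRing.isSubmodClosed.Build R V image_mod image_mod_closed.

Definition coker := quotmod image_mod.
HB.instance Definition _ := GRing.Lmodule.on coker.

End ImageModule.

Section HomModule.
Variables (R : comNzRingType) (A B : lmodType R).

Definition linear_pred : {pred A -> B} :=
  fun f => `[< linear f >].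

Fact linear_pred_closed : submod_closed linear_pred.
Proof.
split.
  by apply/asboolP=> a u v; rewrite /GRing.zero /= scaler0 addr0.
move=> a f g /asboolP lf /asboolP lg; apply/asboolP=> b u v /=.
have E (h k : A -> B) w : (a *: h + k) w = a *: h w + k w by [].
rewrite !E lf lg !scalerDr !scalerA mulrC.
by rewrite -!addrA; congr (_ + _); rewrite addrCA.
Qed.

HB.instance Definition _ :=
  GRing.isSubmodClosed.Build R (A -> B) linear_pred linear_pred_closed.

Record Hom := MkHom { hom_fun :> A -> B; _ : hom_fun \in linear_pred }.

HB.instance Definition _ := [isSub for hom_fun].
HB.instance Definition _ := [Choice of Hom by <:].
HB.instance Definition _ := [SubChoice_isSubLmodule of Hom by <:].

Definition hom_of (f : A -> B) (lf : linear f) : Hom := MkHom (asboolT lf).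

End HomModule.

(* Complexes ... -> C 1 -> C 0 of R-modules, in nonnegative degrees. *)
Record complex (R : comNzRingType) := Complex {
  cmod :> nat -> lmodType R;
  cdiff : forall i, {linear cmod i.+1 -> cmod i};
  cdiffK : forall i u, cdiff i (cdiff i.+1 u) = 0 }.
Arguments cdiff {R} c i.

Section Complexes.
Variable R : comNzRingType.
Implicit Types C L : complex R.

(* C(+1), without its term of degree -1 *)
Definition cshift C : complex R :=
  @Complex R (fun i => C i.+1) (fun i => cdiff C i.+1)
    (fun i => @cdiffK R C i.+1).

Definition coker_proj C (u : C 0%N) : coker (cdiff C 0) := qproj _ u.

Record chain_map L C := ChainMap {
  chain_fun :> forall i, {linear L i -> C i};
  chain_comm : forall i u,
    chain_fun i (cdiff L i u) = cdiff C i (chain_fun i.+1 u) }.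

Definition fin_free (M : lmodType R) : Prop :=
  exists (b : nat) (f : {linear 'rV[R]_b -> M}), bijective f.

(* v lies in the submodule m M of M *)
Definition in_ideal_mul (m : {pred R}) (M : lmodType R) (v : M) : Prop :=
  exists (k : nat) (c : 'I_k -> R) (w : 'I_k -> M),
    (forall i, c i \in m) /\ v = \sum_i c i *: w i.

(* ... -> L 1 -> L 0 -eps-> M -> 0 is a minimal free resolution of M over the
   local ring with maximal ideal m. *)
Definition minimal_free_resolution (m : {pred R}) (M : lmodType R) L
    (eps : {linear L 0%N -> M}) : Prop :=
  [/\ forall i, fin_free (L i),
      (forall w, exists u, eps u = w) /\
      (forall u, eps u = 0 <-> exists v, cdiff L 0 v = u),
      forall i u, cdiff L i u = 0 <-> exists v, cdiff L i.+1 v = u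
    & forall i u, in_ideal_mul m (cdiff L i u)].

(* f : L -> C lifts j : M -> N, along eps : L 0 -> M and pi : C 0 -> N. *)
Definition lifts L C (M N : lmodType R) (eps : L 0%N -> M) (pi : C 0%N -> N)
    (j : M -> N) (f : chain_map L C) : Prop :=
  forall u, pi (f 0%N u) = j (eps u).

(* The first homology of C, as a submodule of coker (C 2 -> C 1) *)
Definition H1_pred C : {pred coker (cdiff C 1)} :=
  fun g => `[< exists z, cdiff C 0 z = 0 /\ qproj _ z = g >].

Fact H1_pred_closed C : submod_closed (@H1_pred C).
Proof.
split; first by apply/asboolP; exists 0; rewrite !linear0.
move=> a _ _ /asboolP[u [du <-]] /asboolP[v [dv <-]]; apply/asboolP.
by exists (a *: u + v); rewrite !linearP /= du dv scaler0 addr0.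
Qed.

HB.instance Definition _ C :=
  GRing.isSubmodClosed.Build R (coker (cdiff C 1)) (@H1_pred C)
    (@H1_pred_closed C).

Record H1 C := MkH1 { H1_val :> coker (cdiff C 1); _ : H1_val \in @H1_pred C }.

HB.instance Definition _ C := [isSub for @H1_val C].
HB.instance Definition _ C := [Choice of H1 C by <:].
HB.instance Definition _ C := [SubChoice_isSubLmodule of H1 C by <:].

Lemma H1_cycle C (h : H1 C) : cdiff C 0 (repr (H1_val h)) = 0.
Proof.
case: h => g /= /asboolP[z [dz gz]].
have /asboolP[w /= wE] : repr g - z \in image_mod (cdiff C 1).
  by apply/qproj_eq; rewrite qprojK gz.
by rewrite -[repr g](subrK z) -wE linearD cdiffK dz addr0.
Qed.

End Complexes.
Arguments coker_proj {R} C u.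

(* The Koszul complex on a_0, ..., a_(r-1). Its term of degree i is free on
   the e_S = e_(s_1) /\ ... /\ e_(s_i), S = {s_1 < ... < s_i} an i-subset of
   'I_r, and the differential sends e_S to the sum over j in S of
   (-1)^#{k in S | k < j} a_j e_(S \ j). Elements are coefficient families,
   so the coefficient of the image of f on e_T sums over j outside T. *)
Section Koszul.
Variables (R : comNzRingType) (r : nat) (a : r.-tuple R).

Definition ksubset (i : nat) := {S : {set 'I_r} | #|S| == i}.
Definition kmod (i : nat) : lmodType R := {ffun ksubset i -> R^o}.

(* The coefficient of e_S (zero if S does not have i elements) *)
Definition kcoef i (f : kmod i) (S : {set 'I_r}) : R :=
  if insub S is Some T then (f : {ffun ksubset i -> R^o}) T else 0.

Definition ksign (T : {set 'I_r}) (j : 'I_r) : R :=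
  (-1) ^+ #|[set k in T | (k < j)%N]|.

Definition kdiff_fun i (f : kmod i.+1) : kmod i :=
  [ffun T : ksubset i => \sum_(j | j \notin val T)
     ksign (val T) j * tnth a j * kcoef f (j |: val T)].

Lemma kcoefP i b (f g : kmod i) S :
  kcoef (b *: f + g) S = b * kcoef f S + kcoef g S.
Proof.
by rewrite /kcoef; case: insubP => [T _ _|_]; rewrite ?ffunE // mulr0 addr0.
Qed.

Fact kdiff_linear i : linear (@kdiff_fun i).
Proof.
move=> b f g; apply/ffunP=> T; rewrite !ffunE scaler_sumr -big_split.
apply: eq_bigr => j _; rewrite kcoefP mulrDr; congr (_ + _); exact: mulrCA.
Qed.

HB.instance Definition _ i :=
  GRing.isLinear.Build R (kmod i.+1) (kmod i) *:%R (@kdiff_fun i)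
    (@kdiff_linear i).

Lemma kcoef_diff i (f : kmod i.+1) (T : {set 'I_r}) : #|T| = i ->
  kcoef (kdiff_fun f) T =
  \sum_(j | j \notin T) ksign T j * tnth a j * kcoef f (j |: T).
Proof.
move=> cT; rewrite {1}/kcoef insubT ?cT // => p.
by rewrite ffunE.
Qed.

Lemma ksign_anti (T : {set 'I_r}) (j k : 'I_r) :
  j \notin T -> k \notin T -> (j < k)%N ->
  ksign T j * ksign (j |: T) k = - (ksign T k * ksign (k |: T) j).
Proof.
move=> jT kT ltjk; rewrite /ksign.
have -> : [set l in j |: T | (l < k)%N] = j |: [set l in T | (l < k)%N].
  by apply/setP=> l; rewrite !inE; case: eqP => [->|]; rewrite ?ltjk.
have -> : [set l in k |: T | (l < j)%N] = [set l in T | (l < j)%N].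
  apply/setP=> l; rewrite !inE; case: eqP => //= ->.
  by rewrite (negPf kT) ltnNge (ltnW ltjk).
rewrite cardsU1 inE (negPf jT) /= exprS mulN1r mulrN.
by rewrite mulrC.
Qed.

Fact kdiffK i (f : kmod i.+2) : kdiff_fun (kdiff_fun f) = 0.
Proof.
apply/ffunP=> T; rewrite !ffunE; case: T => T /= /eqP cT.
pose F (j k : 'I_r) := ksign T j * ksign (j |: T) k * (tnth a j * tnth a k) *
  kcoef f (k |: (j |: T)).
transitivity (\sum_(j | j \notin T) \sum_(k | (k \notin T) && (k != j)) F j k).
  apply: eq_bigr => j jT; rewrite kcoef_diff ?cardsU1 ?jT ?cT // mulr_sumr.
  apply: eq_big => [k|k _]; first by rewrite !inE negb_or andbC.
  rewrite /F !mulrA; congr (_ * _); congr (_ * _).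
  by rewrite -!mulrA; congr (_ * _); rewrite mulrC.
have FA j k : j \notin T -> k \notin T -> (j < k)%N -> F j k = - F k j.
  move=> jT kT ltjk; rewrite /F ksign_anti // !mulNr setUCA.
  by rewrite [tnth a j * _]mulrC.
have sp j : \sum_(k | (k \notin T) && (k != j)) F j k =
  \sum_(k | (k \notin T) && (j < k)%N) F j k +
  \sum_(k | (k \notin T) && (k < j)%N) F j k.
  rewrite (bigID (fun k : 'I_r => (j < k)%N)) /=; congr (_ + _);
  apply: eq_bigl => k; rewrite -andbA; case: (k \notin T) => //=;
  by rewrite -(inj_eq val_inj) /= neq_ltn; case: ltngtP.
rewrite (eq_bigr _ (fun j _ => sp j)) big_split /=.
rewrite [X in _ + X](exchange_big_dep (fun k => k \notin T)) /=; last first.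
  by move=> j k _ /andP[].
rewrite -big_split big1 //= => j jT.
rewrite [X in _ + X](_ : _ =
   \sum_(k | (k \notin T) && (j < k)%N) - F j k).
  by rewrite sumrN subrr.
apply: eq_big => [k|k]; first by rewrite jT /=.
by case/andP=> kT /andP[_ ltjk]; rewrite (FA j k) ?opprK.
Qed.

Definition koszul : complex R :=
  @Complex R kmod (fun i => (@kdiff_fun i : {linear kmod i.+1 -> kmod i}))
    kdiffK.

(* K_r = R, through the coefficient of e_0 /\ ... /\ e_(r-1). *)
Definition ktop (z : koszul r) : R := kcoef z [set: 'I_r].

(* The augmentation K_0 = R -> R / (a) *)
Definition kaug (z : koszul 0) : quotmod (idealgen a) :=
  qproj (idealgen a) (kcoef z set0).

End Koszul.
Arguments ktop {R r} a z.
Arguments kaug {R r} a z.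

Section Omega.
Variables (R : comNzRingType) (d : nat) (x : d.-tuple R) (lam : R).

Definition xlam : d.+1.-tuple R := rcons_tuple x lam.

Definition Omega : lmodType R :=
  Hom (quotmod (idealgen xlam)) (quotmod (idealgen x)).

(* Evaluation at 1 identifies Omega with the ideal (x : lam) / x of R / x. *)
Definition Omega_incl (w : Omega) : quotmod (idealgen x) :=
  (w : Hom _ _) (qproj _ (1 : R^o)).

(* The coordinate at lam, the last of x_1, ..., x_d, lam *)
Definition lam_coef (z : koszul xlam 1) : R := kcoef z [set ord_max].

Lemma kdiff0E (z : koszul xlam 1) :
  kcoef (cdiff (koszul xlam) 0 z) set0 =
  \sum_(j < d) tnth x j * kcoef z [set widen_ord (leqnSn d) j]
    + lam * lam_coef z.
Proof.
rewrite kcoef_diff ?cards0 //.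
have s0 (j : 'I_d.+1) : ksign R set0 j = 1.
  by rewrite /ksign (_ : [set _ in _ | _] = set0) ?cards0 //;
     apply/setP=> k; rewrite !inE.
rewrite (eq_bigl xpredT); last by move=> j; rewrite inE.
rewrite big_ord_recr /= s0 mul1r setU0 /lam_coef; congr (_ + _ * _).
  apply: eq_bigr => j _; rewrite s0 mul1r setU0 !(tnth_nth 0) /=.
  by rewrite nth_rcons size_tuple ltn_ord.
by rewrite (tnth_nth 0) /= nth_rcons size_tuple ltnn eqxx.
Qed.

Lemma idealgen_tnth n (a : n.-tuple R) j : tnth a j \in idealgen a.
Proof.
apply/idealgenP; have ja : (j < size a)%N by rewrite size_tuple.
exists (fun i => (i == Ordinal ja)%:R).
rewrite (bigD1 (Ordinal ja)) //= eqxx mul1r big1 ?addr0 ?(tnth_nth 0) //.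
by move=> i /negPf->; rewrite mul0r.
Qed.

Lemma lam_coef_cycle (z : koszul xlam 1) :
  cdiff (koszul xlam) 0 z = 0 -> lam * lam_coef z \in idealgen x.
Proof.
move=> z0; have := kdiff0E z; rewrite z0 {1}/kcoef.
case: insubP => [T _ _|]; last by rewrite cards0.
rewrite ffunE => /esym/eqP; rewrite addrC addr_eq0 => /eqP->.
rewrite (@rpredN R^o); apply: (@rpred_sum R^o) => j _.
by rewrite mulrC; apply: (@rpredZ _ R^o); apply: idealgen_tnth.
Qed.

Lemma mul_idealgen_xlam (t s : R) :
  lam * t \in idealgen x -> s \in idealgen xlam -> s * t \in idealgen x.
Proof.
move=> lt /idealgenP[c ->]; rewrite mulr_suml; apply: (@rpred_sum R^o) => i _.
rewrite -mulrA; apply: (@rpredZ _ R^o).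
have id : (i < d.+1)%N by rewrite -[X in (_ < X)%N](size_tuple xlam).
move: (nat_of_ord i) id => k id.
rewrite nth_rcons size_tuple; case: ltnP => [ltid|led].
  rewrite mulrC; apply: (@rpredZ _ R^o).
  by have := idealgen_tnth x (Ordinal ltid); rewrite (tnth_nth 0).
have -> : k = d by apply/eqP; rewrite eqn_leq led -ltnS id.
by rewrite eqxx.
Qed.

Lemma lam_coefP b (y z : koszul xlam 1) :
  lam_coef (b *: y + z) = b * lam_coef y + lam_coef z.
Proof. exact: kcoefP. Qed.

(* Boundaries have lam-coordinate in x. *)
Lemma lam_coef_boundary (w : koszul xlam 2) :
  lam_coef (cdiff (koszul xlam) 1 w) \in idealgen x.
Proof.
rewrite /lam_coef kcoef_diff ?cards1 //; apply: (@rpred_sum R^o) => j.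
rewrite inE -(inj_eq val_inj) /= => jd.
have ltjd : (j < d)%N by rewrite ltn_neqAle jd -ltnS ltn_ord.
rewrite mulrAC; apply: (@rpredZ _ R^o).
rewrite (tnth_nth 0) /= nth_rcons size_tuple ltjd.
by rewrite -[j : nat]/(Ordinal ltjd : nat) -tnth_nth idealgen_tnth.
Qed.

Fact Omega_mul_linear (t : R) : lam * t \in idealgen x ->
  linear (fun q : quotmod (idealgen xlam) => qproj (idealgen x) (repr q * t)).
Proof.
move=> lt a u v; rewrite -linearP; apply/qproj_eq.
have -> : repr (a *: u + v) * t - (a *: (repr u * t : R^o) + repr v * t) =
          (repr (a *: u + v) - (a *: (repr u : R^o) + repr v)) * t.
  by rewrite mulrBl mulrDl -scalerAl.
apply: mul_idealgen_xlam => [//|]; apply/(qproj_eq (idealgen xlam)).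
by rewrite linearP /= !qprojK.
Qed.

(* The canonical map from H_1(x, lam; R) to Omega: the class of a cycle z goes
   to the map sending 1 to the class of the lam-coordinate of z. *)
Definition H1_Omega (h : H1 (koszul xlam)) : Omega :=
  hom_of (Omega_mul_linear (lam_coef_cycle (H1_cycle h))).

Lemma H1_OmegaE (h : H1 (koszul xlam)) (z : koszul xlam 1) :
  H1_val h = qproj _ z ->
  Omega_incl (H1_Omega h) = qproj (idealgen x) (lam_coef z : R^o).
Proof.
move=> hz; have lt := lam_coef_cycle (H1_cycle h).
apply/qproj_eq; set s := repr _; set t := lam_coef _.
rewrite -[s * t](subrK t) -addrA; apply: (@rpredD R^o).
  rewrite -[X in _ - X]mul1r -mulrBl; apply: mul_idealgen_xlam => //.
  by apply/(qproj_eq (idealgen xlam)); rewrite qprojK.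
have /asboolP[w wE] : repr (H1_val h) - z \in image_mod (cdiff (koszul xlam) 1).
  by apply/qproj_eq; rewrite qprojK.
rewrite (_ : t - _ = lam_coef (cdiff (koszul xlam) 1 w)) ?lam_coef_boundary //.
by rewrite wE -[_ - z]addrC -scaleN1r lam_coefP mulN1r addrC.
Qed.

End Omega.
Arguments Omega_incl {R d} x lam w.
Arguments H1_Omega {R d} x lam h.

(* Main.v *)
(* The coefficient of e_lam is a chain map from K(x, lam)(+1) to K(x), an
   isomorphism in degree d, and on H_1(x, lam) it induces the identification
   with Omega. Composing it with psi thus gives a second lift of the inclusion
   of Omega into R / x to K(x). As K(x) is acyclic, the two lifts are
   homotopic; since K_(d+1)(x) = 0, in degree d they differ by a map that
   factors through the differential of L, whose image is in m L by minimality.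
   So the two maps L_d -> R agree modulo m, and one is onto iff the other is. *)
Require Import Defs.
From HB Require Import structures.
From mathcomp Require Import all_boot all_order all_algebra.
From mathcomp Require Import generic_quotient ring_quotient boolp functions.
From mathcomp Require classical_sets.

Set Implicit Arguments.
Unset Strict Implicit.
Unset Printing Implicit Defensive.

Import GRing.Theory.
Local Open Scope ring_scope.

(** * Maximal ideals and units of a local ring *)

Section LocalRing.
Variable R : comNzRingType.
Implicit Types (I J m : {pred R}).

Lemma idealr_closed_sum I k (c w : 'I_k -> R) :
  idealr_closed I -> (forall i, c i \in I) -> \sum_i c i * w i \in I.
Proof.
case=> I0 _ ID cI; elim/big_ind: _ => // [u v uI vI|i _].
  by rewrite -[u]mul1r ID.
by rewrite mulrC -[_ * _]addr0 ID.
Qed.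

Lemma exists_maximal_ideal I : idealr_closed I ->
  exists J, maximal_ideal J /\ {subset I <= J}.
Proof.
move=> [I0 I1 ID].
pose proper_above (A : R -> Prop) := [/\ forall u, u \in I -> A u, ~ A 1 &
  forall a u v, A u -> A v -> A (a * u + v)].
(* The union of the empty chain is the empty set, which is not an ideal; the guard [exists u, A u]
   lets it satisfy the predicate. *)
have [|A [PA maxA]] := @classical_sets.Zorn_bigcup R
  (fun A => (exists u, A u) -> proper_above A).
  move=> F FP totF [u [X FX Xu]].
  have PF Y v : F Y -> Y v -> proper_above Y.
    by move=> FY Yv; apply: FP; last by exists v.
  have [IX _ _] := PF _ _ FX Xu; split.
  - by move=> v vI; exists X => //; apply: IX.
  - by case=> Y FY Y1; case: (PF _ _ FY Y1).
  move=> a v w [Y FY Yv] [Z FZ Zw].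
  have [_ _ DY] := PF _ _ FY Yv; have [_ _ DZ] := PF _ _ FZ Zw.
  have [YZ|ZY] := totF _ _ FY FZ.
    by exists Z => //; apply: DZ => //; apply: YZ.
  by exists Y => //; apply: DY => //; apply: ZY.
have PI : proper_above (fun u => u \in I).
  split=> [u uI||]; [exact: uI|exact/negP|exact: ID].
(* The maximal set is not empty, since otherwise [I] itself would be strictly larger. *)
have [IA A1 AD] : proper_above A.
  apply: PA; apply: contrapT => A0; apply: (maxA (fun u => u \in I)) => //.
  split=> [u Au|IA]; first by case: A0; exists u.
  by apply: A0; exists 0; apply: IA.
exists ((fun u => `[< A u >]) : {pred R}).
split; last by move=> u uI; apply/asboolP/IA.
split.
  split; [exact/asboolP/IA|by apply/negP=> /asboolP|].
  by move=> a u v /asboolP Au /asboolP Av; apply/asboolP/AD.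
move=> J [J0 J1 JD] AJ u; apply/idP/idP; last exact: AJ.
move=> uJ; apply: contrapT => uA; apply: (maxA (fun u => u \in J)).
  split=> [v Av|JA]; first exact/AJ/asboolP.
  by apply: uA; apply/asboolP/JA.
move=> _; split; [|exact/negP|exact: JD].
by move=> v vI; apply/AJ/asboolP/IA.
Qed.

(** The multiples of a non-unit [a] form a proper ideal; a maximal ideal above it must be [m], so
    [a] would lie in [m]. *)
Lemma local_unit m a : noetherian_local m -> a \notin m ->
  exists b, b * a = 1.
Proof.
case=> _ _ uniqm am; apply: contrapT => aU.
pose I : {pred R} := fun u => `[< exists b, b * a = u >].
have [|J [/uniqm Jm IJ]] := @exists_maximal_ideal I.
  split.
  - by apply/asboolP; exists 0; rewrite mul0r.
  - by apply/negP=> /asboolP.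
  move=> c _ _ /asboolP[b <-] /asboolP[e <-]; apply/asboolP.
  by exists (c * b + e); rewrite mulrDl mulrA.
by case/negP: am; rewrite -Jm; apply/IJ/asboolP; exists 1; rewrite mul1r.
Qed.

(** If [f u = 1], then [g u] is 1 modulo [m], hence a unit, and multiples of [u] reach every value
    of [g]. *)
Lemma surjective_congr_maximal m (M : lmodType R) (f g : {linear M -> R^o}) :
  noetherian_local m -> (forall u, f u - g u \in m) ->
  (forall r, exists u, f u = r) -> (forall r, exists u, g u = r).
Proof.
move=> locm fg fS r; have [u fu] := fS 1.
have [_ [idm _] _] := locm; have [_ m1 mD] := idm.
have [|b bg] := @local_unit m (g u) locm.
  apply: contra m1 => gm; rewrite -fu -[f u](subrK (g u)) -[_ - _]mul1r.
  exact: mD.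
by exists ((r * b) *: u); rewrite linearZ /= -[RHS]mulr1 -bg mulrA.
Qed.

End LocalRing.

(** * Comparison of chain maps from a free complex to an acyclic one *)

Section Homotopy.
Variable R : comNzRingType.

(** Finite free modules are projective: choose preimages of the images of a basis and extend
    linearly. *)
Lemma fin_free_lift (L A M : lmodType R) (f : {linear L -> M})
    (q : {linear A -> M}) : fin_free L ->
  (forall u, exists v, q v = f u) ->
  exists h : {linear L -> A}, forall u, q (h u) = f u.
Proof.
move=> [b [e [e' eK e'K]]] qf.
have [v vE] := choice (fun i => qf (e (delta_mx 0 i))).
have e'P : linear e'.
  by move=> a u w; apply: (can_inj eK); rewrite linearP !e'K.
pose h u := \sum_i e' u 0 i *: v i.
have hP : linear h.
  move=> a u w; rewrite /h scaler_sumr -big_split; apply: eq_bigr => i _.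
  by rewrite e'P !mxE scalerDl scalerA.
pose hL := GRing.isLinear.Build R L A *:%R h hP.
pose h' : {linear L -> A} := HB.pack h hL.
exists h' => u /=; rewrite -[u in RHS]e'K [e' u in RHS]row_sum_delta.
rewrite !linear_sum; apply: eq_bigr => i _.
by rewrite !linearZ vE.
Qed.

(** Exactness is asked in positive degrees only, so [C] resolves the cokernel of its first
    differential. *)
Definition acyclic (C : complex R) :=
  forall i u, cdiff C i u = 0 -> exists v, cdiff C i.+1 v = u.

Variables (L C : complex R) (f g : chain_map L C).
Hypotheses (freeL : forall i, fin_free (L i)) (acC : acyclic C).
Hypothesis fg0 : forall u, exists v, cdiff C 0 v = f 0%N u - g 0%N u.

(** By the hypothesis on [h], the map [D] takes its values in cycles; these are boundaries by
    acyclicity, and freeness of [L] makes the choice of preimages linear. *)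
Lemma homotopy_step i (h : {linear L i -> C i.+1}) :
  (forall u, cdiff C i (h (cdiff L i u)) =
    f i (cdiff L i u) - g i (cdiff L i u)) ->
  exists k : {linear L i.+1 -> C i.+2}, forall u,
    cdiff C i.+1 (k u) = f i.+1 u - g i.+1 u - h (cdiff L i u).
Proof.
move=> hE; pose D : {linear L i.+1 -> C i.+1} :=
  (f i.+1 \- g i.+1) \- (h \o cdiff L i).
apply: (fin_free_lift (f := D)) => // u; apply: acC.
by rewrite /= !linearB /= -!chain_comm hE subrr.
Qed.

(** Restricting the homotopy identity to boundaries kills the term from the previous degree, so the
    induction carries a single map [h]. *)
Lemma homotopy_boundary i : exists h : {linear L i -> C i.+1}, forall u,
  cdiff C i (h (cdiff L i u)) = f i (cdiff L i u) - g i (cdiff L i u).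
Proof.
elim: i => [|i [h hE]].
  have [h hE] := fin_free_lift (f := f 0%N \- g 0%N) (freeL 0) fg0.
  by exists h => u; rewrite hE.
have [k kE] := homotopy_step hE; exists k => u.
by rewrite kE cdiffK linear0 subr0.
Qed.

Lemma chain_homotopy i : exists (h : {linear L i -> C i.+1})
    (k : {linear L i.+1 -> C i.+2}), forall u,
  f i.+1 u - g i.+1 u = cdiff C i.+1 (k u) + h (cdiff L i u).
Proof.
have [h hE] := homotopy_boundary i; have [k kE] := homotopy_step hE.
by exists h, k => u; rewrite kE subrK.
Qed.

End Homotopy.

(** * Coefficients of Koszul chains, and boundaries in degree 0 *)

Section KoszulCoefficients.
Variables (R : comNzRingType) (r : nat) (a : r.-tuple R).

Lemma kcoef_finfun i (F : {set 'I_r} -> R) (S : {set 'I_r}) : #|S| = i ->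
  kcoef ([ffun T : ksubset r i => F (val T)] : kmod R r i) S = F S.
Proof. by move=> cS; rewrite /kcoef insubT ?cS // => p; rewrite ffunE. Qed.

Lemma kcoef_inj i (f g : kmod R r i) :
  (forall S : {set 'I_r}, #|S| = i -> kcoef f S = kcoef g S) -> f = g.
Proof.
move=> fg; apply/ffunP=> T; have := fg (val T) (eqP (valP T)).
by rewrite /kcoef valK.
Qed.

Lemma kcoef0 i (S : {set 'I_r}) : kcoef (0 : kmod R r i) (S : {set 'I_r}) = 0.
Proof. by rewrite /kcoef; case: insubP => // T _ _; rewrite ffunE. Qed.

Lemma kmod_eq0 i (f : kmod R r i) : (r < i)%N -> f = 0.
Proof.
move=> ri; apply: kcoef_inj => S cS.
by have := max_card S; rewrite cS card_ord leqNgt ri.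
Qed.

Lemma idealgen_tupleP b :
  b \in idealgen a <-> exists c : 'I_r -> R, b = \sum_j c j * tnth a j.
Proof.
split=> [/idealgenP[c ->]|[c ->]].
  exists (fun j => c (cast_ord (esym (size_tuple a)) j)).
  rewrite (reindex (cast_ord (esym (size_tuple a)))) /=.
    by apply: eq_bigr => j _; rewrite (tnth_nth 0).
  by apply: onW_bij; exists (cast_ord (size_tuple a)) => j; apply: val_inj.
by apply: (@rpred_sum R^o) => j _; apply: (@rpredZ _ R^o); apply: idealgen_tnth.
Qed.

Lemma koszul0_boundaryP (u : koszul a 0) :
  kcoef u set0 \in idealgen a <-> exists v, cdiff (koszul a) 0 v = u.
Proof.
have diff0E v : kcoef (cdiff (koszul a) 0 v) set0 =
    \sum_j kcoef v [set j] * tnth a j.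
  rewrite kcoef_diff ?cards0 //; apply: eq_big => [j|j _]; first by rewrite inE.
  rewrite /ksign (_ : [set _ in _ | _] = set0).
    by rewrite cards0 mul1r setU0 mulrC.
  by apply/setP=> k; rewrite !inE.
split=> [/idealgen_tupleP[c uE]|[v <-]]; last first.
  by apply/idealgen_tupleP; exists (fun j => kcoef v [set j]).
(* Summing [c] over a singleton is a way to read off its value at the only element. *)
exists [ffun S : ksubset r 1 => \sum_(j in val S) c j].
apply: kcoef_inj => S /eqP; rewrite cards_eq0 => /eqP->.
rewrite diff0E uE; apply: eq_bigr => j _.
rewrite (kcoef_finfun (fun S : {set 'I_r} => \sum_(j in S) c j)) ?cards1 //.
by rewrite big_set1.
Qed.

End KoszulCoefficients.

(** * Subsets of ['I_d.+1] with and without the last index, and their signs *)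

Section Widen.
Variable d : nat.
Notation widen := (@widen_ord d d.+1 (leqnSn d)).
Implicit Types (T : {set 'I_d}) (S : {set 'I_d.+1}).

Definition widen_set T : {set 'I_d.+1} := [set widen j | j in T].

Lemma widen_ord_leqnSn_inj : injective widen.
Proof. by move=> i j /(congr1 val) /= ij; apply: val_inj. Qed.

Lemma in_widen_set T j : (widen j \in widen_set T) = (j \in T).
Proof. exact: (mem_imset _ _ widen_ord_leqnSn_inj). Qed.

Lemma widen_neq_max j : (widen j == ord_max) = false.
Proof. by rewrite -(inj_eq val_inj) /= ltn_eqF. Qed.

Lemma max_notin_widen_set T : (ord_max \in widen_set T) = false.
Proof.
apply/imsetP=> -[j _ /eqP]; by rewrite eq_sym widen_neq_max.
Qed.

Lemma card_widen_set T : #|widen_set T| = #|T|.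
Proof. exact: card_imset widen_ord_leqnSn_inj. Qed.

Lemma card_max_widen_set T : #|ord_max |: widen_set T| = #|T|.+1.
Proof. by rewrite cardsU1 max_notin_widen_set card_widen_set. Qed.

Lemma widen_setU1 j T : widen_set (j |: T) = widen j |: widen_set T.
Proof. by rewrite /widen_set imsetU1. Qed.

Lemma ord_max_or_widen (k : 'I_d.+1) : k = ord_max \/ exists j, k = widen j.
Proof.
have [kd|dk] := ltnP k d; last first.
  by left; apply: val_inj; apply/eqP; rewrite eqn_leq dk -ltnS ltn_ord.
by right; exists (Ordinal kd); apply: val_inj.
Qed.

Lemma set_widenP S : exists T, S = widen_set T \/ S = ord_max |: widen_set T.
Proof.
exists [set j | widen j \in S].
have [maxS|maxS] := boolP (ord_max \in S); [right|left]; apply/setP=> k;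
  have [->|[j ->]] := ord_max_or_widen k;
  by rewrite ?inE ?widen_neq_max ?in_widen_set ?max_notin_widen_set ?eqxx
    ?inE // (negPf maxS).
Qed.

Lemma preim_widen_set T : widen @^-1: widen_set T = T.
Proof. by apply/setP=> j; rewrite inE in_widen_set. Qed.

Lemma preim_max_widen_set T : widen @^-1: (ord_max |: widen_set T) = T.
Proof. by apply/setP=> j; rewrite !inE widen_neq_max in_widen_set. Qed.

Variable R : comNzRingType.

Lemma ksign_widen T j : ksign R (widen_set T) (widen j) = ksign R T j.
Proof.
rewrite /ksign -card_widen_set; congr (_ ^+ #|pred_of_set _|).
apply/setP=> k; have [->|[l ->]] := ord_max_or_widen k.
  by rewrite !inE !max_notin_widen_set.
by rewrite !inE !in_widen_set !inE.
Qed.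

(** The sign counts smaller indices, and the last index is never one of them. *)
Lemma ksign_max_widen T j :
  ksign R (ord_max |: widen_set T) (widen j) = ksign R T j.
Proof.
rewrite -ksign_widen /ksign; congr (_ ^+ #|pred_of_set _|).
apply/setP=> k; rewrite !inE; have [->|//] := eqVneq k ord_max.
by rewrite max_notin_widen_set /= ltnNge ltnW ?ltn_ord.
Qed.

Lemma ksign_widen_max T : ksign R (widen_set T) ord_max = (-1) ^+ #|T|.
Proof.
rewrite /ksign -card_widen_set; congr (_ ^+ #|pred_of_set _|).
apply/setP=> k; rewrite inE; have [->|[l ->]] := ord_max_or_widen k.
  by rewrite max_notin_widen_set.
by rewrite /= ltn_ord andbT.
Qed.

End Widen.

(** * The Koszul complex on [x], [lam] as a mapping cone, and its acyclicity *)

Section KoszulSplit.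
Variables (R : comNzRingType) (d : nat) (x : d.-tuple R) (lam : R).
Notation widen := (@widen_ord d d.+1 (leqnSn d)).
Notation K := (koszul x).
Notation Kl := (koszul (xlam x lam)).

Lemma tnth_xlam_widen j : tnth (xlam x lam) (widen j) = tnth x j.
Proof. by rewrite !(tnth_nth 0) /= nth_rcons size_tuple ltn_ord. Qed.

Lemma tnth_xlam_max : tnth (xlam x lam) ord_max = lam.
Proof. by rewrite (tnth_nth 0) /= nth_rcons size_tuple ltnn eqxx. Qed.

(* K_i(x, lam) = K_i(x) + K_(i-1)(x) /\ e_lam, the two coordinates being
   x_part and lam_part. *)
Definition x_part i (z : Kl i) : K i :=
  [ffun T : ksubset d i => kcoef z (widen_set (val T))].

Definition lam_part i (z : Kl i.+1) : K i :=
  [ffun T : ksubset d i => kcoef z (ord_max |: widen_set (val T))].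

Definition kjoin i (v : K i.+1) (w : K i) : Kl i.+1 :=
  [ffun S : ksubset d.+1 i.+1 => if ord_max \in val S
     then kcoef w (widen @^-1: val S) else kcoef v (widen @^-1: val S)].

Lemma x_partE i (z : Kl i) (T : {set 'I_d}) : #|T| = i ->
  kcoef (x_part z) T = kcoef z (widen_set T).
Proof. exact: (kcoef_finfun (fun T => kcoef z (widen_set T))). Qed.

Lemma lam_partE i (z : Kl i.+1) (T : {set 'I_d}) : #|T| = i ->
  kcoef (lam_part z) T = kcoef z (ord_max |: widen_set T).
Proof. exact: (kcoef_finfun (fun T => kcoef z (ord_max |: widen_set T))). Qed.

Lemma kjoinE i (v : K i.+1) (w : K i) (S : {set 'I_d.+1}) : #|S| = i.+1 ->
  kcoef (kjoin v w) S = if ord_max \in S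
     then kcoef w (widen @^-1: S) else kcoef v (widen @^-1: S).
Proof.
exact: (kcoef_finfun (fun S => if ord_max \in S
     then kcoef w (widen @^-1: S) else kcoef v (widen @^-1: S))).
Qed.

Lemma kparts_inj i (y z : Kl i.+1) :
  x_part y = x_part z -> lam_part y = lam_part z -> y = z.
Proof.
move=> xyz lyz; apply: kcoef_inj => S; have [T [->|->]] := set_widenP S.
  by rewrite card_widen_set => cT; rewrite -!x_partE // xyz.
by rewrite card_max_widen_set => -[cT]; rewrite -!lam_partE // lyz.
Qed.

Lemma x_part_join i (v : K i.+1) (w : K i) : x_part (kjoin v w) = v.
Proof.
apply: kcoef_inj => T cT; rewrite x_partE // kjoinE ?card_widen_set //.
by rewrite max_notin_widen_set preim_widen_set.
Qed.

Lemma lam_part_join i (v : K i.+1) (w : K i) : lam_part (kjoin v w) = w.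
Proof.
apply: kcoef_inj => T cT.
rewrite lam_partE // kjoinE ?card_max_widen_set ?cT //.
by rewrite !inE eqxx preim_max_widen_set.
Qed.

Lemma x_part0 i : x_part (0 : Kl i) = 0.
Proof. by apply: kcoef_inj => T cT; rewrite x_partE // !kcoef0. Qed.

Fact lam_part_linear i : linear (@lam_part i).
Proof.
move=> b y z; apply: kcoef_inj => T cT.
by rewrite kcoefP !lam_partE // kcoefP.
Qed.

HB.instance Definition _ i :=
  GRing.isLinear.Build R (Kl i.+1) (K i) *:%R (@lam_part i)
    (@lam_part_linear i).

(** On a set containing the last index the differential only adds indices of [x], and their signs
    ignore the last index. *)
Lemma lam_part_diff i (z : Kl i.+2) :
  lam_part (cdiff Kl i.+1 z) = cdiff K i (lam_part z).
Proof.
apply: kcoef_inj => T cT.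
rewrite lam_partE // !kcoef_diff ?card_max_widen_set ?cT //.
rewrite big_mkcond big_ord_recr /= !inE eqxx addr0 [RHS]big_mkcond /=.
apply: eq_bigr => j _; rewrite !inE widen_neq_max in_widen_set /=.
case: ifP => // jT; rewrite ksign_max_widen tnth_xlam_widen lam_partE.
  by rewrite widen_setU1 setUCA.
by rewrite cardsU1 jT cT.
Qed.

(** The extra term comes from adding the last index to [T]; all [i] elements of [T] precede it,
    whence the sign. *)
Lemma x_part_diff i (z : Kl i.+1) :
  x_part (cdiff Kl i z) =
  cdiff K i (x_part z) + ((-1) ^+ i * lam) *: lam_part z.
Proof.
apply: kcoef_inj => T cT; rewrite x_partE // addrC kcoefP.
rewrite !kcoef_diff ?card_widen_set ?cT //.
rewrite big_mkcond big_ord_recr /= max_notin_widen_set /= addrC.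
rewrite ksign_widen_max tnth_xlam_max cT lam_partE //; congr (_ + _).
rewrite [RHS]big_mkcond; apply: eq_bigr => j _; rewrite in_widen_set.
case: ifP => // jT; rewrite ksign_widen tnth_xlam_widen x_partE.
  by rewrite widen_setU1.
by rewrite cardsU1 jT cT.
Qed.

(** Lift the two coordinates of a cycle in turn: first the [lam] one to [w], then the [x] one
    corrected by a multiple of [w]. *)
Lemma koszul_xlam_acyclic : acyclic K ->
  (forall b, lam * b \in idealgen x -> b \in idealgen x) -> acyclic Kl.
Proof.
move=> acK reglam i z z0.
have [w wE] : exists w, cdiff K i w = lam_part z.
  case: i z z0 => [|i] z z0; last first.
    apply: acK; rewrite -lam_part_diff z0; exact: linear0.
  (* In degree 0 acyclicity says nothing; the cycle equation puts [lam] times the coefficient in the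
     ideal of [x], and regularity of [lam] cancels it. *)
  apply/koszul0_boundaryP/reglam.
  have /esym/eqP := x_part_diff z; rewrite z0 x_part0 expr0 mul1r.
  rewrite addr_eq0 => /eqP xE.
  suff: - (lam * kcoef (lam_part z) set0) \in idealgen x.
    by rewrite (@rpredN R^o).
  rewrite (_ : - _ = kcoef (cdiff K 0 (x_part z)) set0).
    by apply/koszul0_boundaryP; exists (x_part z).
  by rewrite xE -[- (lam *: _)]addr0 -scaleNr kcoefP kcoef0 addr0 mulNr.
have [|v vE] := acK i (x_part z - ((-1) ^+ i.+1 * lam) *: w).
  rewrite linearB linearZ /= wE.
  have := x_part_diff z; rewrite z0 x_part0 exprS mulN1r mulNr scaleNr opprK.
  by move<-.
exists (kjoin v w); apply: kparts_inj.
  by rewrite x_part_diff x_part_join lam_part_join vE subrK.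
by rewrite lam_part_diff lam_part_join wE.
Qed.

End KoszulSplit.

Lemma regular_sequence_acyclic (R : comNzRingType) d (x : d.-tuple R) :
  regular_sequence x -> acyclic (koszul x).
Proof.
case=> regx _; elim: d x regx => [|d IHd] x regx.
  by move=> i u _; exists 0; rewrite linear0 [u]kmod_eq0.
(* The sequence is peeled from its end, as regularity of an entry is modulo the preceding ones. *)
case: x regx => s; case/lastP: s => // s lam sz regx.
have szs : size s == d by rewrite -eqSS -(size_rcons s lam).
have -> : Tuple sz = xlam (Tuple szs) lam by apply: val_inj.
apply: koszul_xlam_acyclic.
  apply: IHd => i /= id b; have := regx i.
  rewrite /= size_rcons ltnS => /(_ (ltnW id) b).
  by rewrite nth_rcons id -cats1 takel_cat // ltnW.
move=> b; have := regx (size s); rewrite /= size_rcons ltnSn => /(_ isT b).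
by rewrite nth_rcons ltnn eqxx -cats1 take_size_cat.
Qed.

(** * The second lift, obtained from [psi] by taking the [lam] coordinate *)

Section LamChain.
Variables (R : comNzRingType) (d : nat) (x : d.-tuple R) (lam : R).
Variables (L : complex R) (psi : chain_map L (cshift (koszul (xlam x lam)))).

Definition lam_chain_map : chain_map L (koszul x) :=
  @ChainMap R L (koszul x) (fun i => @lam_part R d x lam i \o psi i)
    (fun i u => etrans (congr1 (@lam_part R d x lam i) (chain_comm psi u))
                       (lam_part_diff (psi i.+1 u))).

Lemma ktop_lam_chain_map u :
  ktop x (lam_chain_map d u) = ktop (xlam x lam) (psi d u).
Proof.
rewrite /ktop lam_partE ?cardsT ?card_ord //; congr kcoef.
apply/setP=> k; rewrite !inE; have [->|[j ->]] := ord_max_or_widen k.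
  by rewrite eqxx.
by rewrite in_widen_set inE orbT.
Qed.

(** [psi 0 u] represents the class [theta (eps u)], and [H1_OmegaE] allows any representative to
    compute its image in [R / x]. *)
Lemma lam_chain_map_lifts (eps : {linear L 0%N -> Omega x lam})
    (theta : Omega x lam -> H1 (koszul (xlam x lam))) :
  cancel theta (H1_Omega x lam) ->
  lifts eps (coker_proj (cshift (koszul (xlam x lam))))
    (fun w => H1_val (theta w)) psi ->
  lifts eps (kaug x) (Omega_incl x lam) lam_chain_map.
Proof.
move=> thetaK psiE u; rewrite -[eps u]thetaK (H1_OmegaE (esym (psiE u))).
rewrite /kaug lam_partE ?cards0 // /lam_coef; congr (qproj _ (kcoef _ _)).
by rewrite /widen_set imset0 setU0.
Qed.

End LamChain.

Lemma lifts_congr_top (R : comNzRingType) (m : {pred R}) d (x : d.-tuple R)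
    (L : complex R) (M : lmodType R) (eps : {linear L 0%N -> M})
    (j : M -> quotmod (idealgen x)) (f g : chain_map L (koszul x)) :
  idealr_closed m -> regular_sequence x -> minimal_free_resolution m eps ->
  lifts eps (kaug x) j f -> lifts eps (kaug x) j g ->
  forall u, ktop x (f d u) - ktop x (g d u) \in m.
Proof.
move=> idm regx [freeL _ _ minL] fE gE u.
have kcoefB i (y z : koszul x i) S : kcoef (y - z) S = kcoef y S - kcoef z S.
  by rewrite addrC -scaleN1r kcoefP mulN1r addrC.
have fg0 v : exists w, cdiff (koszul x) 0 w = f 0%N v - g 0%N v.
  apply/koszul0_boundaryP; rewrite kcoefB; apply/(qproj_eq (idealgen x)).
  exact: etrans (fE v) (esym (gE v)).
have acK := regular_sequence_acyclic regx.
have m0 : 0 \in m by case: idm.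
rewrite /ktop -kcoefB.
case: d x j f g regx fE gE kcoefB fg0 acK u =>
  [|d] x j f g regx fE gE kcoefB fg0 acK u.
  (* For [d = 0] no differential leaves [L 0], but the two lifts differ by a boundary from
     [K_1 = 0], so they agree. *)
  by have [w <-] := fg0 u; rewrite [w]kmod_eq0 // linear0 kcoef0.
have [h [k fgE]] := chain_homotopy freeL acK fg0 d.
(* [k u] lies one degree above the top of the Koszul complex; only [h] after the differential of [L]
   remains. *)
rewrite fgE [k u]kmod_eq0 // linear0 add0r.
have [b [c [w [cm ->]]]] := minL d u.
rewrite linear_sum /=.
rewrite (_ : kcoef _ _ = \sum_i c i * kcoef (h (w i)) [set: 'I_d.+1]).
  exact: idealr_closed_sum.
rewrite (big_morph (fun z => kcoef z [set: 'I_d.+1])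
  (id1 := 0) (op1 := +%R)) => [|y z|]; last exact: kcoef0.
  apply: eq_bigr => i _; rewrite linearZ /=.
  by rewrite -[_ *: _]addr0 kcoefP kcoef0 addr0.
by rewrite -[y]scale1r kcoefP mul1r scale1r.
Qed.

Fact ktop_linear (R : comNzRingType) r (a : r.-tuple R) :
  linear (ktop a : _ -> R^o).
Proof. by move=> b y z; exact: kcoefP. Qed.

HB.instance Definition _ (R : comNzRingType) r (a : r.-tuple R) :=
  GRing.isLinear.Build R (koszul a r) R^o *:%R (ktop a) (@ktop_linear R r a).

Theorem mainTheorem6 (R : comNzRingType) (m : {pred R}) (n d : nat)
    (x : d.-tuple R) (lam : R)
    (locR : noetherian_local m) (dimR : krull_dim R n)
    (xm : {subset x <= m}) (regx : regular_sequence x)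
    (lam_zero_divisor :
       exists q : quotmod (idealgen x), q != 0 /\ lam *: q = 0)
    (lam_not_param : ~ is_parameter m x lam)
    (* a minimal free resolution L of Omega *)
    (L : complex R) (eps : {linear L 0%N -> Omega x lam})
    (resL : minimal_free_resolution m eps)
    (* Omega ~ H_1(x, lam; R) is the inverse of the canonical isomorphism *)
    (theta : Omega x lam -> H1 (koszul (xlam x lam)))
    (thetaK : cancel theta (H1_Omega x lam))
    (OmegaK : cancel (H1_Omega x lam) theta)
    (psi : chain_map L (cshift (koszul (xlam x lam))))
    (psi_lifts : lifts eps (coker_proj (cshift (koszul (xlam x lam))))
                   (fun w => H1_val (theta w)) psi)
    (phi : chain_map L (koszul x))
    (phi_lifts : lifts eps (kaug x) (Omega_incl x lam) phi) :
  (forall r : R, exists u : L d, ktop (xlam x lam) (psi d u) = r) <->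
  (forall r : R, exists u : L d, ktop x (phi d u) = r).
Proof.
have [_ [idm _] _] := locR.
have lam_lifts := lam_chain_map_lifts thetaK psi_lifts.
pose top (f : chain_map L (koszul x)) : {linear L d -> R^o} := ktop x \o f d.
have congr_top f g := lifts_congr_top (f := f) (g := g) idm regx resL.
split=> [psiS|phiS].
  apply: (surjective_congr_maximal (f := top (lam_chain_map psi)) (g := top phi)
    locR) => [u|r]; first exact: congr_top.
  by have [u <-] := psiS r; exists u; rewrite -ktop_lam_chain_map.
move=> r; have [|u uE] := surjective_congr_maximal (f := top phi)
  (g := top (lam_chain_map psi)) locR _ phiS r.
  by move=> u; apply: congr_top.
by exists u; rewrite -ktop_lam_chain_map.
Qed.
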